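(* Let $b\ge 2$ and let $S$ be a standard skew tableau with $b$ nonempty rows whose row vector is decreasing (row lengths weakly decrease from top to bottom). Then $S$ stabilizes at $2b-2$.
   Context: Tableaux use English notation; rows are indexed from top to bottom. A standard skew tableau with $m$ cells is a filling of a skew shape by $1,\dots,m$, each used once, increasing along rows and down columns. The row vector of a skew tableau is the sequence of its row lengths from top to bottom; it is ''decreasing'' if these lengths weakly decrease from top to bottom. $\operatorname{Rect}(S)$ denotes the jeu de taquin rectification of $S$. For a standard skew tableau $S$ with $m$ cells and decreasing row vector and $k\ge 1$, $S^{(k)}$ is the standard skew tableau obtained by attaching $k-1$ shifted copies of $S$ to the right of $S$: row $i$ of $S^{(k)}$ begins in the same column as row $i$ of $S$ and consists of the entries of row $i$ of $S$, followed by these entries plus $m$, followed by these entries plus $2m$, ..., followed by these entries plus $(k-1)m$. $S$ stabilizes at $k$ if every entry in $[(k-1)m+1,km]$ lies in the same row of $\operatorname{Rect}(S^{(k)})$ as in $S^{(k)}$. *)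

(* Defs.v *)
From mathcomp Require Import all_boot.
Set Implicit Arguments. Unset Strict Implicit. Unset Printing Implicit Defensive.

(* A skew tableau in English notation is given as a list of rows, top row first.
   Row i is a pair (offset, entries): its cells are in columns
   offset, offset+1, ..., offset + size entries - 1 (columns counted from 0).
   So the inner shape is mu_i = offset and the outer shape lambda_i = offset + size. *)
Definition skrow := (nat * seq nat)%type.
Definition sktab := seq skrow.

Definition inner (S : sktab) : seq nat := [seq p.1 | p <- S].
Definition outer (S : sktab) : seq nat := [seq p.1 + size p.2 | p <- S].
Definition row_vector (S : sktab) : seq nat := [seq size p.2 | p <- S].
Definition ncells (S : sktab) : nat := sumn (row_vector S).

Definition grid := seq (seq (option nat)).
Definition to_grid (S : sktab) : grid := [seq nseq p.1 None ++ map Some p.2 | p <- S].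
Definition cell (T : grid) (i j : nat) : option nat := nth None (nth [::] T i) j.

(* Standard skew tableau with m = ncells S cells: lambda/mu a skew shape
   (mu, lambda partitions, mu <= lambda automatically), filled with 1..m each once,
   increasing along rows and down columns. *)
Definition standard_skew (S : sktab) : Prop :=
  [/\ sorted geq (inner S), sorted geq (outer S),
      perm_eq (flatten [seq p.2 | p <- S]) (iota 1 (ncells S)),
      all (fun p => sorted ltn p.2) S &
      forall i j x y, cell (to_grid S) i j = Some x ->
                      cell (to_grid S) i.+1 j = Some y -> x < y].

Definition kpower (S : sktab) (k : nat) : sktab :=
  [seq (p.1, flatten [seq map (addn (t * ncells S)) p.2 | t <- iota 0 k]) | p <- S].

Definition setc (T : grid) i j (v : option nat) : grid :=
  set_nth [::] T i (set_nth None (nth [::] T i) j v).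

(* A jeu de taquin slide: the empty cell is at (i,j); the smaller of its right
   and lower neighbours slides into it; when it has no such neighbour the
   empty cell is removed from the shape.  n is fuel. *)
Fixpoint slide_from (n : nat) (T : grid) (i j : nat) : grid :=
  match n with
  | 0 => T
  | n'.+1 =>
    match cell T i j.+1, cell T i.+1 j with
    | Some x, Some y =>
        if x < y then slide_from n' (setc T i j (Some x)) i j.+1
        else slide_from n' (setc T i j (Some y)) i.+1 j
    | Some x, None => slide_from n' (setc T i j (Some x)) i j.+1
    | None, Some y => slide_from n' (setc T i j (Some y)) i.+1 j
    | None, None => set_nth [::] T i (take j (nth [::] T i))
    end
  end.

Definition slide_fuel (T : grid) : nat := (size T + sumn [seq size r | r <- T]).+1.

Definition hole_rows (T : grid) : seq nat :=
  [seq i <- iota 0 (size T) | None \in nth [::] T i].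

(* One slide into the inner corner at the end of the inner shape of the lowest
   row that still has inner cells (this is an inner corner). *)
Definition rect_step (T : grid) : grid :=
  match rev (hole_rows T) with
  | [::] => T
  | r :: _ => slide_from (slide_fuel T) T r
                (find (fun o => o != None) (nth [::] T r)).-1
  end.

(* Rectification: perform slides until the inner shape is empty
   (one slide per inner cell). *)
Definition rect (T : grid) : grid :=
  iter (count (pred1 None) (flatten T)) rect_step T.

Definition Rect (S : sktab) : grid := rect (to_grid S).

Definition row_of (T : grid) (v : nat) : nat := find (fun r => Some v \in r) T.

Definition stabilizes_at (S : sktab) (k : nat) : Prop :=
  forall v, (k.-1 * ncells S < v <= k * ncells S) ->
    row_of (Rect (kpower S k)) v = row_of (to_grid (kpower S k)) v.

(* Main.v *)
Require Import Defs.
From mathcomp Require Import all_boot zify.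
Set Implicit Arguments. Unset Strict Implicit. Unset Printing Implicit Defensive.

(* Encode a standard skew tableau by the word of the rows of its entries.
   Following the row of the empty cell through time, a slide changes a letter
   h+1 into h exactly when the empty cell is in row h and the subtableau of
   smaller entries has no room for a new cell in row h+1.  Rectification fills
   the holes of the rows from bottom to top; the slides into row i together
   change a letter r > i into r-1 exactly when row r of the old shape is as long
   as row r-1 of the new one.  For a periodic word with weakly decreasing
   content, comparing shapes one period apart shows that such a change at row r
   stops one period after the letters r and r-1 have become periodic again.
   Numbering the b rows from 0, changes r -> r-1 in stage i thus stop after
   (b-1-i) + (r-i-1) periods, which is at most 2b-3. *)

(** * Rows with holes and the shapes of subtableaux *)

Definition oval (o : option nat) := odflt 0 o.
(** Holes, read as [0], sort to the left end of a row, and banning the entry [0] keeps them apart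
    from entries. The order is weak because a slide in progress duplicates an entry. *)
Definition row_ok (s : seq (option nat)) :=
  sorted (relpre oval leq) s && (Some 0 \notin s).
(** Holes are counted too: [shp T 0] is the inner shape, and [shp T v] the outer shape of the part
    with entries at most [v]. *)
Definition shp (T : grid) (v k : nat) :=
  count (fun o => oval o <= v) (nth [::] T k).

Lemma shp_default T v k : size T <= k -> shp T v k = 0.
Proof. by move=> h; rewrite /shp nth_default. Qed.

Lemma row_ok_nth T k : all row_ok T -> row_ok (nth [::] T k).
Proof.
move=> h; case: (ltnP k (size T)) => hk; last by rewrite nth_default.
exact: (allP h) (mem_nth _ hk).
Qed.

(** In a sorted row the values at most [v] form an initial segment; this translates between shapes
    and cells. *)
Lemma ltn_count_row s v l : sorted (relpre oval leq) s ->
  (l < count (fun o => oval o <= v) s) =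
  (l < size s) && (oval (nth None s l) <= v).
Proof.
elim: s l => [|x s IH] l //= hs.
have tr : transitive (relpre oval leq) by move=> a c d /=; exact: leq_trans.
case: (leqP (oval x) v) => hx.
  by case: l => [|l] //=; rewrite -(IH l (path_sorted hs)).
have /allP hm := order_path_min tr hs.
have -> : count (fun o => oval o <= v) s = 0.
  apply/eqP; rewrite -leqn0 leqNgt -has_count; apply/hasPn => y /hm /=.
  by rewrite -ltnNge; apply: leq_trans.
apply/esym/negP => /andP[]; case: l => [|l] /= hl; first by rewrite leqNgt hx.
by move=> /(leq_trans (hm _ (mem_nth None hl))); rewrite leqNgt hx.
Qed.

Lemma ltn_shp T v k l : all row_ok T ->
  (l < shp T v k) = (l < size (nth [::] T k)) && (oval (cell T k l) <= v).
Proof. by move=> /(row_ok_nth k)/andP[h _]; exact: ltn_count_row. Qed.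

Lemma row_ok_set s j x : row_ok s -> j < size s -> 0 < x ->
  oval (nth None s j) <= x ->
  (j.+1 < size s -> x <= oval (nth None s j.+1)) ->
  row_ok (set_nth None s j (Some x)).
Proof.
move=> /andP[hs h0] hj x0 hl hr; apply/andP; split.
  apply/(sortedP None) => i; rewrite size_set_nth (maxn_idPr hj) => hi /=.
  rewrite !nth_set_nth /=.
  have hsi := sortedP None hs _ hi.
  have [e|_] := eqVneq i j; have [e'|_] := eqVneq i.+1 j => //=.
  - by subst i; exact: hr.
  - by subst j; exact: leq_trans hsi hl.
apply/negP => /(nthP None)[i]; rewrite size_set_nth (maxn_idPr hj) => hi.
rewrite nth_set_nth /=; case: eqP => [_ [e]|_ e]; first by rewrite e in x0.
by move/negP: h0; apply; rewrite -e mem_nth.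
Qed.

Lemma cell_gt0 T k l x : all row_ok T -> cell T k l = Some x -> 0 < x.
Proof.
move=> /(row_ok_nth k)/andP[_ h0] e.
case: x e => // e; case/negP: h0; rewrite -e mem_nth //.
by rewrite ltnNge; apply/negP => h; rewrite /cell nth_default in e.
Qed.

Lemma cellP T k l x : cell T k l = Some x -> l < size (nth [::] T k) /\ k < size T.
Proof.
rewrite /cell => e; split; rewrite ltnNge; apply/negP => h.
  by rewrite nth_default in e.
by rewrite (nth_default [::] h) nth_nil in e.
Qed.

(** * One jeu de taquin slide, followed through the values *)

Section Setc.
Variables (T : grid) (i j x : nat).
Hypotheses (hi : i < size T) (hj : j < size (nth [::] T i)).
Let T1 := setc T i j (Some x).

Lemma size_setc : size T1 = size T.
Proof. by rewrite size_set_nth (maxn_idPr hi). Qed.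

Lemma nth_setc k : nth [::] T1 k =
  if k == i then set_nth None (nth [::] T i) j (Some x) else nth [::] T k.
Proof. by rewrite /T1 /setc nth_set_nth /=. Qed.

Lemma size_row_setc k : size (nth [::] T1 k) = size (nth [::] T k).
Proof.
by rewrite nth_setc; case: eqP => // ->; rewrite size_set_nth (maxn_idPr hj).
Qed.

Lemma cell_setc k l : cell T1 k l =
  if (k == i) && (l == j) then Some x else cell T k l.
Proof.
by rewrite /cell nth_setc; case: eqP => //= ->; rewrite nth_set_nth.
Qed.

Lemma shp_setc v k :
  shp T1 v k + (k == i) * (oval (cell T i j) <= v) = shp T v k + (k == i) * (x <= v).
Proof.
rewrite /shp nth_setc; case: eqP => [->|]; last by lia.
rewrite count_set_nth_ltn // /cell !mul1n /= subnK //.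
rewrite -(cat_take_drop j (nth [::] T i)) (drop_nth None hj) count_cat /=.
by rewrite nth_cat size_take hj ltnn subnn /=; lia.
Qed.

Lemma row_ok_setc : all row_ok T -> 0 < x -> oval (cell T i j) <= x ->
  (j.+1 < size (nth [::] T i) -> x <= oval (cell T i j.+1)) -> all row_ok T1.
Proof.
move=> ok x0 hl hr; apply/(all_nthP [::]) => k _.
rewrite nth_setc; case: eqP => _; last exact: row_ok_nth.
by apply: row_ok_set => //; exact: row_ok_nth.
Qed.
End Setc.

(* [h v] is the row of the empty cell once the entries [<= v] have moved. *)
Record slid (T T' : grid) (z i : nat) (h : nat -> nat) : Prop := Slid {
  slid_size : size T' = size T;
  slid_ok : all row_ok T';
  slid_start : h z = i;
  slid_shp : forall v k, shp T v k = shp T' v k + (z <= v) && (k == h v);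
  slid_lt : forall v, z <= v -> shp T v (h v).+1 < shp T v (h v);
  slid_next : forall v, z <= v -> h v.+1 = h v \/
    [/\ h v.+1 = (h v).+1, shp T v.+1 (h v).+1 = (shp T v (h v).+1).+1 &
        shp T v (h v) = (shp T v (h v).+1).+1] }.

(** Prepends one move to the history of the rest of a slide. The empty cell is a hole of value [0]
    or still carries a copy of the entry that has just left it, so its value [z] is the time at
    which the history starts; the next move happens at time [x]. *)
Lemma slid_step T T' i j i' x h1 : i < size T -> j < size (nth [::] T i) ->
  let z := oval (cell T i j) in
  z <= x ->
  (forall v, z <= v < x -> shp T v i = j.+1) ->
  (forall v, z <= v < x -> shp T v i.+1 <= j) ->
  i' = i \/ [/\ i' = i.+1, z < x, shp T x i' = j.+1 & shp T x.-1 i' = j] ->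
  slid (setc T i j (Some x)) T' x i' h1 ->
  exists h, slid T T' z i h.
Proof.
move=> hi hj z zx hri hrb hi' [s1 ok1 st1 sh1 lt1 nx1].
have sT := shp_setc x hi hj.
have sz := size_setc j x hi.
exists (fun v => if v < x then i else h1 v).
split => //.
- by rewrite s1 sz.
- by case: ltnP => // xz; case: hi' => [<-|[_ ? _ _]]; [rewrite -st1; congr h1|]; lia.
- move=> v k; move: (sT v k) (sh1 v k); rewrite -/z.
  case: (ltnP v x) => vx; last by rewrite (leq_trans zx vx) /=; lia.
  by case: (z <= v); case: (k == i) => /=; lia.
- move=> v zv /=; case: (ltnP v x) => vx.
    have hv : z <= v < x by rewrite zv.
    by rewrite hri // ltnS hrb.
  move: (sT v (h1 v).+1) (sT v (h1 v)) (lt1 v vx); rewrite vx -/z zv !muln1.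
  lia.
move=> v zv /=; case: (ltnP v.+1 x) => vx; first by left; rewrite (ltnW vx).
case: (ltnP v x) => vx2.
  have ev : x = v.+1 by lia.
  rewrite -ev st1; case: hi' => [->|[-> zx1 e1 e2]]; [by left|right].
  rewrite e1 hri ?zv // -e1; move: e1 e2; rewrite ev /= => -> ->.
  by split.
have := nx1 v vx2.
move: (sT v (h1 v).+1) (sT v.+1 (h1 v).+1) (sT v (h1 v)); rewrite vx2 vx -/z zv (leq_trans zv (leqnSn v)) !muln1.
by move=> /addIn <- /addIn <- /addIn <-.
Qed.

(** Induction on the fuel: each move raises [i + j] by one. The bound of one new cell per value
    concerns rows below [i], since row [i] may hold the duplicate of the moving entry. *)
Lemma slide_from_slid n T i j :
  i < size T -> j < size (nth [::] T i) ->
  (forall k, size (nth [::] T k) + size T <= n + i + j) ->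
  all row_ok T ->
  (forall l, j < l < size (nth [::] T i) -> cell T i l <> None) ->
  (forall k, i < k -> None \notin nth [::] T k) ->
  (forall v k, i < k -> shp T v.+1 k <= (shp T v k).+1) ->
  (forall k l y, i <= k -> cell T k.+1 l = Some y -> oval (cell T k l) < y) ->
  exists h, slid T (slide_from n T i j) (oval (cell T i j)) i h.
Proof.
elim: n T i j => [|n IH] T i j hi hj hn ok hR hD hinc hC.
  by have := hn i; lia.
have shpE := ltn_shp _ _ _ ok.
rewrite /=; set z := oval (cell T i j).
have rgt x : cell T i j.+1 = Some x -> (forall y, cell T i.+1 j = Some y -> x < y) ->
    exists h, slid T (slide_from n (setc T i j (Some x)) i j.+1) z i h.
  move=> ex hxy.
  have [hj1 _] := cellP ex.
  have zx : z <= x.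
    have /andP[hs _] := row_ok_nth i ok.
    by have := sortedP None hs _ hj1; rewrite /= -!/(cell _ _ _) ex.
  have [||||||||h hh] := IH (setc T i j (Some x)) i j.+1.
  - by rewrite size_setc.
  - by rewrite size_row_setc.
  - by move=> k; rewrite size_setc // size_row_setc //; have := hn k; lia.
  - by apply: row_ok_setc => //; rewrite ?ex //; exact: cell_gt0 ex.
  - move=> l; rewrite size_row_setc // cell_setc eqxx /= => hl.
    by case: eqP => // _; apply: hR; lia.
  - by move=> k hk; rewrite nth_setc gtn_eqF //; exact: hD.
  - move=> v k hk; move: (shp_setc x hi hj v k) (shp_setc x hi hj v.+1 k).
    by rewrite gtn_eqF // !mul0n !addn0 => -> ->; exact: hinc.
  - move=> k l y hk; rewrite !cell_setc gtn_eqF //= => ey.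
    case: andP => [[/eqP ek /eqP el]|_]; last exact: hC ey.
    by subst k l; apply: hxy.
  move: hh; rewrite cell_setc eqxx gtn_eqF // /= ex /= => hh.
  apply: (slid_step hi hj zx _ _ _ hh); last by left.
    move=> v /andP[zv vx]; apply/eqP; rewrite eqn_leq shpE hj -/z zv andbT.
    by rewrite andbT leqNgt shpE ex /=; apply/negP => /andP[_]; lia.
  move=> v /andP[zv vx]; rewrite leqNgt shpE; apply/negP => /andP[hs].
  case ey : (cell T i.+1 j) (hD i.+1 (ltnSn i)) => [y|] /=.
    by move=> _; have := hxy _ ey; lia.
  by rewrite -ey /cell mem_nth.
have dwn y : cell T i.+1 j = Some y -> (forall x, cell T i j.+1 = Some x -> y <= x) ->
    exists h, slid T (slide_from n (setc T i j (Some y)) i.+1 j) z i h.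
  move=> ey hxy.
  have [hj1 hi1] := cellP ey.
  have zy : z < y by apply: hC ey.
  have hrx : j.+1 < size (nth [::] T i) -> y <= oval (cell T i j.+1).
    move=> hj2; have := hR j.+1; rewrite ltnSn hj2 /=.
    by case ex : (cell T i j.+1) => [x|] // => [_|/(_ isT)] //; exact: hxy.
  have [||||||||h hh] := IH (setc T i j (Some y)) i.+1 j.
  - by rewrite size_setc.
  - by rewrite size_row_setc.
  - by move=> k; rewrite size_setc // size_row_setc //; have := hn k; lia.
  - by apply: row_ok_setc => //; [exact: cell_gt0 ey|exact: ltnW].
  - move=> l; rewrite size_row_setc // cell_setc gtn_eqF //= => /andP[_ hl] e.
    by have := hD i.+1 (ltnSn i); rewrite -e /cell mem_nth.
  - by move=> k hk; rewrite nth_setc gtn_eqF ?hD //; lia.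
  - move=> v k hk; have hik : i < k by lia.
    move: (shp_setc y hi hj v k) (shp_setc y hi hj v.+1 k).
    by rewrite gtn_eqF // !mul0n !addn0 => -> ->; exact: hinc.
  - move=> k l w hk; rewrite !cell_setc !(gtn_eqF (_ : i < _)) //=; last by lia.
    by apply: hC; lia.
  move: hh; rewrite cell_setc gtn_eqF //= ey /= => hh.
  (* Row [i.+1] reaches past column [j] exactly at the value [y], which is when the empty cell
     changes rows. *)
  have e0 v : v < y -> shp T v i.+1 <= j.
    by move=> vy; rewrite leqNgt shpE ey /=; apply/negP => /andP[_]; lia.
  have e1 : j < shp T y i.+1 by rewrite shpE hj1 ey /= leqnn.
  have e2 := hinc y.-1 i.+1 (ltnSn i).
  have e3 := e0 y.-1.
  apply: (slid_step hi hj (ltnW zy) _ _ _ hh).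
  - move=> v /andP[zv vx]; apply/eqP; rewrite eqn_leq shpE hj -/z zv andbT.
    by rewrite andbT leqNgt shpE; apply/negP => /andP[/hrx]; lia.
  - by move=> v /andP[_]; exact: e0.
  - by right; split => //; move: e2 e3; rewrite ?prednK; lia.
case ex : (cell T i j.+1) => [x|]; case ey : (cell T i.+1 j) => [y|].
- case: ltnP => hxy; [apply: rgt|apply: dwn] => // ?; first by rewrite ey => -[<-].
  by rewrite ex => -[<-].
- by apply: rgt => // ?; rewrite ey.
- by apply: dwn => // ?; rewrite ex.
have sj : size (nth [::] T i) = j.+1.
  apply/eqP; rewrite eqn_leq hj andbT leqNgt; apply/negP => h.
  by apply: (hR j.+1) => //; rewrite ltnSn.
have nT' k : nth [::] (set_nth [::] T i (take j (nth [::] T i))) k =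
   if k == i then take j (nth [::] T i) else nth [::] T k by rewrite nth_set_nth.
(* With no neighbour left, the empty cell stays in row [i] for all later values. *)
exists (fun=> i); split => //.
- by rewrite size_set_nth (maxn_idPr hi).
- apply/(all_nthP [::]) => k _; rewrite nT'; case: eqP => _; last exact: row_ok_nth.
  have /andP[h1 h2] := row_ok_nth i ok.
  by rewrite /row_ok take_sorted //=; apply: contra h2; exact: mem_take.
- move=> v k; rewrite /shp nT' andbC; case: eqP => [->|_]; last by rewrite addn0.
  rewrite -{1}(cat_take_drop j (nth [::] T i)) (drop_nth None hj) count_cat /=.
  by rewrite drop_oversize ?sj //= addn0.
- move=> v zv; have h1 : j < shp T v i by rewrite shpE hj.
  suff : shp T v i.+1 <= j by lia.
  rewrite leqNgt shpE; apply/negP => /andP[hs _].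
  by have := hD i.+1 (ltnSn i); rewrite -ey /cell mem_nth.
by left.
Qed.

(** * The row word and the effect of one slide on it *)

Lemma find_holes s : row_ok s ->
  find (fun o => o != None) s = count (fun o => oval o <= 0) s.
Proof.
elim: s => //= x s IH /andP[hs h0].
have hs' : row_ok s.
  by rewrite /row_ok (path_sorted hs); apply: contra h0; rewrite inE orbC => ->.
case: x hs h0 => [x|] /= hs h0; last by rewrite IH.
have x0 : 0 < x by rewrite lt0n; apply: contra h0 => /eqP->; rewrite mem_head.
have := @ltn_count_row (Some x :: s) 0 0 hs.
by rewrite /= [x <= 0]leqNgt x0 /= add0n; case: count.
Qed.

(* [w v] is the row of the entry [v.+1]; it is [size T] or more when there is
   no such entry. *)
Record tab (T : grid) (w : nat -> nat) : Prop := Tab {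
  tab_ok : all row_ok T;
  tab_col : forall v k, shp T v k.+1 <= shp T v k;
  tab_inc : forall v k, k < size T -> shp T v.+1 k = shp T v k + (k == w v) }.

Lemma rect_step_slide T i : all row_ok T -> i < size T -> 0 < shp T 0 i ->
  (forall k, i < k -> shp T 0 k = 0) ->
  rect_step T = slide_from (slide_fuel T) T i (shp T 0 i).-1.
Proof.
move=> ok hi h0 hk; rewrite /rect_step.
have hP k : (None \in nth [::] T k) = (0 < shp T 0 k).
  rewrite -has_count; apply/idP/hasP => [h|[[[|x]|]] // h _]; first by exists None.
  by have /andP[_] := row_ok_nth k ok; rewrite h.
have -> : rev (hole_rows T) = i :: rev [seq k <- iota 0 i | None \in nth [::] T k].
  rewrite /hole_rows -(subnKC hi) addSnnS iotaD filter_cat rev_cat /=.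
  rewrite add0n hP h0 rev_cons -cats1.
  rewrite [filter _ _](_ : _ = [::]) //; apply/eqP; rewrite -[_ == _]negbK -has_filter.
  apply/hasPn => k; rewrite mem_iota hP => /andP[ik _].
  by rewrite hk.
by rewrite find_holes //; exact: row_ok_nth.
Qed.

(** The entry [v.+1] changes row only when it makes the empty cell descend from row [h v], and then
    it moves up into that row; horizontal moves leave the word alone. *)
Lemma tab_rect_step T w i (T' := rect_step T) : tab T w -> i < size T -> 0 < shp T 0 i ->
  (forall k, i < k -> shp T 0 k = 0) ->
  exists w' h, [/\ tab T' w', size T' = size T, h 0 = i,
   forall v k, shp T v k = shp T' v k + (k == h v) &
   forall v, shp T v (h v).+1 < shp T v (h v) /\
     (h v.+1 = h v /\ w' v = w v \/
      [/\ h v.+1 = (h v).+1, w v = (h v).+1, w' v = h v, (h v).+1 < size T &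
          shp T v (h v) = (shp T v (h v).+1).+1])].
Proof.
move=> [ok col inc] hi h0 hk.
have inc' v k : shp T v.+1 k <= (shp T v k).+1.
  case: (ltnP k (size T)) => h; last by rewrite !shp_default.
  by rewrite inc //; lia.
set j := (shp T 0 i).-1.
have jE : shp T 0 i = j.+1 by rewrite prednK.
have := ltn_shp 0 i j ok; rewrite jE ltnSn => /esym/andP[hj]; rewrite leqn0 => /eqP hz.
have [||||||h hh] := @slide_from_slid (slide_fuel T) T i j hi hj.
- move=> k; rewrite /slide_fuel.
  suff : size (nth [::] T k) <= sumn [seq size r | r <- T] by lia.
  case: (ltnP k (size T)) => h; last by rewrite nth_default.
  rewrite -(cat_take_drop k T) (drop_nth [::] h) map_cat sumn_cat /=.
  by rewrite nth_cat size_take h ltnn subnn /=; lia.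
- by [].
- move=> l /andP[jl ls] e; have := ltn_shp 0 i l ok.
  by rewrite ls e /= jE ltnNge jl.
- move=> k ik; apply/negP => hn; have := hk k ik; apply/eqP; rewrite -lt0n -has_count.
  by apply/hasP; exists None.
- by [].
- move=> k l y _ e; have [hl hk1] := cellP e.
  have y0 := cell_gt0 ok e.
  have hk0 : k < size T by lia.
  (* The value [y] adds a cell to row [k.+1] only, so row [k] is as long at [y.-1] as at [y] and the
     cell above [y] is smaller than [y]. *)
  have h1 := ltn_shp y k.+1 l ok; have h2 := ltn_shp y.-1 k.+1 l ok.
  have h3 := ltn_shp y.-1 k l ok.
  have := inc y.-1 _ hk1; have := inc y.-1 _ hk0; have := col y k.
  rewrite prednK //; move: h1 h2 h3; rewrite e /= leqnn hl /=.
  by case: (ltnP l (size _)) => /=; lia.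
move: hh; rewrite hz -(rect_step_slide ok) // -/T' => -[s1 ok1 st sh lt nx].
exists (fun v => if h v.+1 == h v then w v else h v), h.
have sh' v k : shp T v k = shp T' v k + (k == h v) by exact: sh.
have nx' v : h v.+1 = h v \/ [/\ h v.+1 = (h v).+1, w v = (h v).+1,
   (h v).+1 < size T & shp T v (h v) = (shp T v (h v).+1).+1].
  have [->|[-> e1 e2]] := nx v isT; [by left|right].
  have hs : (h v).+1 < size T by rewrite ltnNge; apply/negP => /(shp_default v.+1); rewrite e1.
  by split => //; have := inc v _ hs; rewrite e1; case: eqP => [->|] //; lia.
split => //.
- split => //.
    move=> v k; have := sh' v k; have := sh' v k.+1; have := col v k.
    have := lt v isT.
    have [->|] := eqVneq k (h v); lia.
  move=> v k; rewrite s1 => hks.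
  have := inc v k hks; have := sh' v k; have := sh' v.+1 k.
  have [->|[-> -> _ _]] := nx' v; first by rewrite eqxx; lia.
  by rewrite (gtn_eqF (ltnSn (h v))); lia.
move=> v; have lt1 := lt v isT; split => //.
have [->|[-> ? ? ?]] := nx' v; first by left; rewrite eqxx.
by right; rewrite gtn_eqF.
Qed.

(** * All slides into one row *)

(** Describes [T] after any number of slides into row [i]. Because [batch_word] compares a row of
    [T0] with a row of the current [T], it is an invariant of these slides. *)
Record batch (i : nat) (T0 : grid) (w0 : nat -> nat) (T : grid) (w : nat -> nat) : Prop :=
Batch {
  batch_tab : tab T w;
  batch_size : size T = size T0;
  batch_holes : forall k, k != i -> shp T 0 k = shp T0 0 k;
  batch_word : forall v, w v =
    if (i < w0 v < size T0) && (shp T0 v (w0 v) == shp T v (w0 v).-1)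
    then (w0 v).-1 else w0 v }.

(** Removing a cell from row [h v] affects the criterion only for the letter [(h v).+1], and there
    it becomes true exactly when the empty cell descends. *)
Lemma batch_step i T0 w0 T w : tab T0 w0 -> i < size T0 ->
  (forall k, i < k -> shp T0 0 k = 0) ->
  batch i T0 w0 T w -> 0 < shp T 0 i ->
  (exists w', batch i T0 w0 (rect_step T) w') /\
  shp (rect_step T) 0 i = (shp T 0 i).-1.
Proof.
move=> t0 hi hk [t sT hT wT] pT.
have hi' : i < size T by rewrite sT.
have hk' k : i < k -> shp T 0 k = 0.
  by move=> ik; rewrite hT ?hk // gtn_eqF.
have [w' [h [t' s' h0 sh hh]]] := tab_rect_step t hi' pT hk'.
(* At each value the empty cell is at least as low as those of the earlier slides into row [i], so
   the rows below it still have their shape in [T0]. *)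
have inv v : i <= h v /\ forall k, h v < k -> shp T v k = shp T0 v k.
  elim: v => [|v [IH1 IH2]].
    by rewrite h0; split => // k ik; rewrite hk // hk'.
  have [_ hv] := hh v.
  have hle : h v <= h v.+1 by case: hv => [[->]|[->]].
  split; first by lia.
  move=> k hvk; case: (ltnP k (size T)) => ks; last by rewrite !shp_default -?sT.
  rewrite (tab_inc t) // (tab_inc t0) -?sT // IH2 ?(leq_ltn_trans hle) //; congr addn.
  rewrite wT; case: ifP => // /andP[/andP[iw ws] /eqP e].
  case: (ltnP (h v) (w0 v)) => hw; last by lia.
  have ws' : w0 v < size T by rewrite sT.
  case: (ltnP (h v).+1 (w0 v)) => hw2.
    (* Both rows lie below the empty cell, so the criterion would make them equally long in [T0]
       just before the lower one grows. *)
    have := tab_inc t0 v ws; have := tab_col t0 v.+1 (w0 v).-1.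
    have wp : (w0 v).-1 < size T0 by lia.
    have := tab_inc t0 v wp; rewrite -IH2 ?e; try lia.
    by rewrite prednK; lia.
  have ew : w0 v = (h v).+1 by lia.
  have [] := hh v; rewrite IH2 // -ew; move: e; rewrite {2}ew /=; lia.
have sh0 : shp (rect_step T) 0 i = (shp T 0 i).-1.
  by have := sh 0 i; rewrite h0 eqxx; lia.
split => //; exists w'; split => //; first by rewrite s'.
  by move=> k ki; rewrite -hT // sh h0 (negbTE ki) addn0.
move=> v; have [iv shE] := inv v; have [lt nx] := hh v.
have shv := sh v; have wv := wT v.
case: (ltnP (w0 v) (size T0)) wv => ws; rewrite ?andbF ?andbT /=; last first.
  by move=> wv; case: nx => [[_ ->]|[_ ? _ ? _]] //; lia.
case: (ltnP i (w0 v)) => iw /=; last first.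
  by move=> wv; case: nx => [[_ ->]|[_ ? _ ? _]] //; lia.
case: (ltnP (h v).+1 (w0 v)) => hw2.
  have := tab_inc t0 v ws; have := tab_col t0 v.+1 (w0 v).-1.
  have wp : (w0 v).-1 < size T0 by lia.
  have := tab_inc t0 v wp; have := shE (w0 v).-1; have := shv (w0 v).-1.
  rewrite prednK; last by lia.
  by case: nx => [[_ ->]|[_ -> -> _]]; do 2!case: ifP => /eqP; lia.
case: (eqVneq (w0 v) (h v).+1) => [ew|nw].
  (* Row [h v] of [T] is longer than the row below, so this letter has not moved yet. It moves now
     if the excess is one cell; if the empty cell stays, strictness at [v.+1] forces a larger
     excess. *)
  move: lt; rewrite ew /= shE // => lt; have := shv (h v).
  rewrite eqxx ltn_eqF // => e wE; case: nx => [[eh ->]|[_ _ -> _ e2]].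
    have [] := hh v.+1; rewrite eh (tab_inc t v) ?sT -?ew // (tab_inc t v) ?sT; last by lia.
    by rewrite wE ew eqxx ltn_eqF // shE //; case: eqP => //; lia.
  by case: eqP => //; have := shE _ (ltnSn (h v)); lia.
have := shv (w0 v).-1.
by case: nx => [[_ ->]|[_ -> -> _]]; do 2!case: ifP => /eqP; lia.
Qed.

Lemma batch_iter i T0 w0 : tab T0 w0 -> i < size T0 ->
  (forall k, i < k -> shp T0 0 k = 0) ->
  exists w, batch i T0 w0 (iter (shp T0 0 i) rect_step T0) w /\
    shp (iter (shp T0 0 i) rect_step T0) 0 i = 0.
Proof.
move=> t0 hi hk; suff h n : n <= shp T0 0 i -> exists w, batch i T0 w0 (iter n rect_step T0) w /\
    shp (iter n rect_step T0) 0 i = shp T0 0 i - n.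
  by have := h _ (leqnn _); rewrite subnn.
elim: n => [_|n IH hn].
  (* Before any slide the criterion never holds, since a row of [T0] would outgrow the one above. *)
  exists w0; rewrite subn0 /=; split => //.
  split => // v; case: ifP => // /andP[/andP[iw ws] /eqP e].
  have wp : (w0 v).-1 < size T0 by lia.
  have := tab_col t0 v.+1 (w0 v).-1; rewrite prednK; last by lia.
  by rewrite !(tab_inc t0) // e eqxx; lia.
have [w [bw e]] := IH (ltnW hn).
have [|[w' bw'] e'] := batch_step t0 hi hk bw; first by rewrite e subn_gt0.
by exists w'; rewrite iterS; split => //; rewrite e' e subnS.
Qed.

(** Row [r] of [T0] starts empty. When it grows while the lengths are equal, the criterion sends the
    same entry to row [r.-1] of [T], which grows too. *)
Lemma batch_interlace i T0 w0 T w r v : tab T0 w0 -> batch i T0 w0 T w ->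
  (forall k, i < k -> shp T0 0 k = 0) -> i < r < size T0 ->
  shp T0 v r <= shp T v r.-1.
Proof.
move=> t0 [t sT _ wE] hk /andP[ir rs]; elim: v => [|v IH]; first by rewrite hk.
have rp : r.-1 < size T by lia.
rewrite (tab_inc t0) // (tab_inc t) //.
have [er|_] := eqVneq r (w0 v); last by lia.
by rewrite wE -er ir rs /=; case: (eqVneq (shp T0 v r)) => ?; lia.
Qed.

(** * Growth over a period and stability of the word *)

Section Compare.
Variables (T U : grid) (w y : nat -> nat) (r s e : nat).
Hypotheses (tT : tab T w) (tU : tab U y) (rT : r < size T) (rU : r < size U).
Hypothesis se : s <= e.

Lemma shp_window_eq : (forall v, s <= v < e -> (w v == r) = (y v == r)) ->
  shp T e r + shp U s r = shp T s r + shp U e r.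
Proof.
elim: e se => [|n IH]; first by rewrite leqn0 => /eqP->.
rewrite leq_eqVlt ltnS => /orP[/eqP-> //|sn] h.
have e1 : shp T n r + shp U s r = shp T s r + shp U n r.
  by apply: IH => // v /andP[sv vn]; apply: h; rewrite sv ltnW.
have := h n; rewrite sn ltnSn (tab_inc tT) // (tab_inc tU) // ![r == _]eq_sym.
by move=> ->//; lia.
Qed.

Lemma shp_window_le : (forall v, s <= v < e -> y v == r -> w v == r) ->
  shp U e r + shp T s r <= shp T e r + shp U s r.
Proof.
elim: e se => [|n IH]; first by rewrite leqn0 => /eqP->; rewrite addnC.
rewrite leq_eqVlt ltnS => /orP[/eqP-> _|sn h]; first by rewrite addnC.
have : shp U n r + shp T s r <= shp T n r + shp U s r.
  by apply: IH => // v /andP[sv vn]; apply: h; rewrite sv ltnW.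
have := h n; rewrite sn ltnSn (tab_inc tT) // (tab_inc tU) // ![r == _]eq_sym.
by case: (y n == r) => [->|_] //; lia.
Qed.
End Compare.

Section Stability.
Variables (b m N : nat) (U : grid) (y R : nat -> nat).
Hypotheses (m_gt0 : 0 < m) (tU : tab U y) (sU : size U = b).
Hypothesis shp_period : forall v r, r < b -> v + m <= N ->
  shp U (v + m) r = shp U v r + R r.
Hypothesis R_noninc : forall r, r.+1 < b -> R r.+1 <= R r.

(* If the entry [v.+1] moved from row [r] up to row [r.-1], row [r.-1] would
   have gained more than [R r.-1] cells over the last period while row [r] of
   [T0] gained [R r], so interlacing would fail one period earlier. *)
Lemma batch_no_push i T0 w0 T w r D : tab T0 w0 -> batch i T0 w0 T w ->
  size T0 = b -> (forall k, i < k -> shp T0 0 k = 0) -> i < r < b ->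
  (forall q v, r.-1 <= q <= r -> D * m <= v < N -> (w0 v == q) = (y v == q)) ->
  (forall v, D * m <= v < N -> w0 v = r.-1 -> w v = r.-1) ->
  forall v, D.+1 * m <= v < N -> w0 v = r -> w v = r.
Proof.
move=> t0 bt s0 hk irb st np v /andP[Dv vN] wv.
have [ir rb] := andP irb.
have [t sT _ wE] := bt.
have := wE v; rewrite wv ir s0 rb /=; case: eqP => // ep wv'.
(* The values from [s] to [v] inclusive make up one full period. *)
set s := v.+1 - m.
have esm : s + m = v.+1 by rewrite mulSn in Dv; rewrite subnK; lia.
have Ds : D * m <= s by rewrite mulSn in Dv; lia.
have rp : r.-1 < b by lia.
have sv : s <= v.+1 by lia.
have rs0 : r < size T0 by rewrite s0.
have rsU : r < size U by rewrite sU.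
have rpU : r.-1 < size U by rewrite sU.
have rpT : r.-1 < size T by rewrite sT s0.
have yv : y v = r.
  by apply/eqP; rewrite -(st r v) ?wv ?eqxx // ?leqnn ?leq_pred //; lia.
have hw u : s <= u < v.+1 -> D * m <= u < N by lia.
have sv' : s <= v by lia.
have h1 := shp_window_eq t0 tU rs0 rsU sv.
have {}h1 := h1 (fun u hu => st r u (_ : r.-1 <= r <= r) (hw u hu)).
have h2 : shp U v r.-1 + shp T s r.-1 <= shp T v r.-1 + shp U s r.-1.
  apply: (shp_window_le t tU) => // u /andP[su uv].
  have hu : D * m <= u < N by apply: hw; rewrite su ltnS ltnW.
  by rewrite -st ?leqnn ?leq_pred // => /eqP/(np u hu)/eqP.
have h3 := batch_interlace s t0 bt hk (_ : i < r < size T0).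
have h4 := shp_period rb (_ : s + m <= N).
have h5 := shp_period rp (_ : s + m <= N).
have h6 := R_noninc (_ : r.-1.+1 < b).
have h7 := tab_inc t v rpT; have h8 := tab_inc t0 v rs0.
have h9 := tab_inc tU v rpU.
(* From [s] to [v], row [r] of [T0] gains [R r - 1] cells, the last one of the period coming at [v]
   itself, while row [r.-1] of [T] gains at least [R r.-1]. Equal lengths at [v] then contradict
   interlacing at [s]. *)
move: h1 h2 h3 h4 h5 h6 h7 h8 h9; rewrite esm wv wv' yv leq_pred leqnn !eqxx.
rewrite prednK; last by lia.
rewrite s0 irb rb vN => /(_ isT) h1 h2 /(_ isT) h3 /(_ isT) h4 /(_ isT) h5 /(_ isT) h6.
lia.
Qed.

(* The number of periods after which stage [i] leaves the letters [j] of the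
   periodic word in place; no entry moves up into the last row, whence
   the [minn]. *)
Definition tau i j := if j < i then 0 else minn (b.-1 - i + (j - i)) ((b.-1 - i).*2.-1).

(** The state in which only the rows above row [i] still have holes: level [b] is [U], level [0] its
    rectification. *)
Record level (i : nat) (T : grid) (w : nat -> nat) : Prop := Level {
  level_tab : tab T w;
  level_size : size T = b;
  level_straight : forall k, i <= k -> shp T 0 k = 0;
  level_holes : forall k, k < i -> shp T 0 k = shp U 0 k;
  level_word : forall j v, j < b -> tau i j * m <= v < N -> (w v == j) = (y v == j) }.

Lemma level_step i T w : level i.+1 T w -> i < b ->
  exists w', level i (iter (shp U 0 i) rect_step T) w'.
Proof.
move=> [t sT st ho wo] ib.
have iT : i < size T by rewrite sT.
have [w' [bt e0]] := batch_iter t iT st.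
rewrite -ho //; set T' := iter _ _ _ in bt e0 *.
have [t' sT' hT' wE] := bt.
(* The letter [i] never moves in this stage; [batch_no_push] then passes stability from each letter
   to the next. *)
have push d v : i + d < b -> (b.-1 - i + d.-1) * m <= v < N ->
    w v = i + d -> w' v = i + d.
  elim: d v => [|d IH] v hd hv wv; first by rewrite wE wv addn0 ltnn.
  apply: (@batch_no_push i T w T' w' (i + d.+1) (b.-1 - i + d).-1) => //.
  - by rewrite hd addnS ltnS leq_addr.
  - move=> q u hq hu; apply: wo; first by lia.
    have h : tau i.+1 q <= (b.-1 - i + d).-1.
      by rewrite /tau; case: ltnP => // ?; lia.
    by case/andP: hu => hu ->; rewrite andbT (leq_trans _ hu) // leq_mul2r h orbT.
  - rewrite addnS /= => u hu wu; case: d IH hd {hv wv} hu wu => [|d] IH hd hu wu.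
      by rewrite wE wu addn0 ltnn.
    apply: IH => //; first by lia.
    by move: hu; rewrite addnS.
  by rewrite prednK //; lia.
exists w'; split => //; first by rewrite sT'.
- move=> k; rewrite leq_eqVlt => /orP[/eqP <- //|ik].
  by rewrite hT' ?st // gtn_eqF.
- by move=> k ki; rewrite hT' ?ltn_eqF // ho // ltnW.
move=> j v jb /andP[hv vN].
have tle : forall D, D <= tau i j -> D * m <= v.
  by move=> D hD; apply: leq_trans hv; rewrite leq_mul2r hD orbT.
rewrite -wo //; last by rewrite vN tle // /tau; case: ltnP => ?; case: ltnP => ?; lia.
rewrite wE sT; case: ifP => // /andP[/andP[iw wb] eq].
have wE' : w' v = (w v).-1 by rewrite wE iw sT wb eq.
(* By [push] a letter can move only before this bound, and [tau i] is at least as large both at the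
   row left and at the row entered. *)
have ns : ~ (b.-1 - i + (w v - i).-1) * m <= v.
  move=> h; have := push (w v - i) v; rewrite subnKC ?(ltnW iw) // wb h vN wE'.
  by move=> /(_ isT isT erefl); lia.
have nj : (w v).-1 <> j.
  by move=> ej; apply: ns; apply: tle; rewrite /tau; case: ltnP => ?; lia.
have nj' : w v <> j.
  by move=> ej; apply: ns; apply: tle; rewrite /tau; case: ltnP => ?; lia.
by move/eqP: nj => /negbTE->; move/eqP: nj' => /negbTE->.
Qed.

(** For [i = b] the sum is the number of holes of [U], which is the number of slides made by
    [rect]. *)
Lemma level_iter i T w : level i T w -> i <= b ->
  exists w', level 0 (iter (\sum_(k < i) shp U 0 k) rect_step T) w'.
Proof.
elim: i T w => [|i IH] T w l ib; first by exists w; rewrite big_ord0.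
have [w' l'] := level_step l ib.
have [w'' l''] := IH _ _ l' (ltnW ib).
by exists w''; rewrite big_ord_recr /= iterD.
Qed.
End Stability.

(** * Powers of [S] as tableaux with a periodic word *)

Lemma nth_to_grid S i : nth [::] (to_grid S) i =
  nseq (nth (0, [::]) S i).1 None ++ map Some (nth (0, [::]) S i).2.
Proof.
case: (ltnP i (size S)) => h; first by rewrite (nth_map (0, [::])).
by rewrite !nth_default // size_map.
Qed.

Lemma shp_to_grid S v i : shp (to_grid S) v i =
  (nth (0, [::]) S i).1 + count (fun x => x <= v) (nth (0, [::]) S i).2.
Proof.
by rewrite /shp nth_to_grid count_cat count_nseq /= mul1n count_map.
Qed.

Lemma row_ok_skew o s : sorted ltn s -> 0 \notin s ->
  row_ok (nseq o None ++ map Some s).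
Proof.
move=> hs h0; apply/andP; split; last first.
  rewrite mem_cat mem_nseq andbF /=; apply/mapP => -[x hx [e]].
  by rewrite e hx in h0.
elim: o => [|o IH] /=.
  rewrite sorted_map; apply: sub_sorted hs => x z /=; exact: ltnW.
rewrite path_sortedE; last by move=> ? ? ? /=; exact: leq_trans.
by rewrite IH andbT; apply/allP.
Qed.

Lemma count_leS (s : seq nat) v :
  count (fun x => x <= v.+1) s = count (fun x => x <= v) s + count_mem v.+1 s.
Proof. by elim: s => //= x s ->; lia. Qed.

Lemma row_of_tab T w v : tab T w -> w v < size T -> row_of T v.+1 = w v.
Proof.
move=> [ok _ inc] hw.
have memE k : k < size T -> (Some v.+1 \in nth [::] T k) = (k == w v).
  move=> hk; have := inc v k hk; rewrite /shp.
  have -> (s : seq (option nat)) : count (fun o => oval o <= v.+1) s =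
      count (fun o => oval o <= v) s + count_mem (Some v.+1) s.
    by elim: s => //= -[x|] s -> /=; rewrite ?(inj_eq Some_inj); lia.
  by move/addnI; rewrite -has_pred1 has_count => ->; case: (_ == _).
rewrite /row_of; case: findP => [/hasPn h|k hk hP hb].
  by have := h _ (mem_nth [::] hw); rewrite memE // eqxx.
by apply/eqP; rewrite -memE //; exact: hP.
Qed.

Lemma find_flatten (S : sktab) i x : uniq (flatten [seq p.2 | p <- S]) ->
  x \in (nth (0, [::]) S i).2 -> find (fun p => x \in p.2) S = i.
Proof.
elim: S i => [|p S IH] [|i] //=; rewrite cat_uniq => /and3P[_ hp hS] hx.
  by rewrite hx.
case: ifP => hxp; last by rewrite (IH i).
case/hasP: hp; exists x => //; apply/flattenP; exists (nth (0, [::]) S i).2 => //.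
apply: map_f; apply: mem_nth; rewrite ltnNge; apply/negP => h.
by rewrite nth_default in hx.
Qed.

Lemma count_holes T : all row_ok T ->
  count (pred1 None) (flatten T) = \sum_(i < size T) shp T 0 i.
Proof.
move=> ok; rewrite count_flatten sumnE big_map (big_nth [::]) big_mkord.
apply: eq_bigr => i _; apply: eq_in_count => -[[|x]|] // h.
by have /andP[_] := row_ok_nth i ok; rewrite h.
Qed.
Section Power.
Variables (S : sktab) (k : nat).
Hypotheses (std : standard_skew S) (dec : sorted geq (row_vector S)).
Hypothesis k_gt0 : 0 < k.
Let m := ncells S.
Let U := to_grid (kpower S k).
Let srow i := (nth (0, [::]) S i).2.
Let urow i := flatten [seq map (addn (t * m)) (srow i) | t <- iota 0 k].

(** Indices start at [0]: [v] stands for the entry [v.+1], located in [S] by its residue. Past the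
    last entry, [size S] is a letter naming no row. *)
Definition letter v :=
  if v < k * m then find (fun p => (v %% m).+1 \in p.2) S else size S.

Lemma size_kpower_grid : size U = size S.
Proof. by rewrite !size_map. Qed.

Lemma nth_kpower i : nth (0, [::]) (kpower S k) i = ((nth (0, [::]) S i).1, urow i).
Proof.
case: (ltnP i (size S)) => h; first by rewrite (nth_map (0, [::])).
rewrite nth_default ?size_map // /urow /srow nth_default //=.
by congr pair; elim: (iota _ _).
Qed.

Lemma mem_srow i x : x \in srow i -> 0 < x <= m.
Proof.
have [_ _ pe _ _] := std => hx.
suff : x \in flatten [seq p.2 | p <- S] by rewrite (perm_mem pe) mem_iota add1n ltnS.
apply/flattenP; exists (srow i) => //; apply: map_f; apply: mem_nth.
rewrite ltnNge; apply/negP => h.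
by rewrite /srow nth_default in hx.
Qed.

Lemma srow_sorted i : sorted ltn (srow i).
Proof.
have [_ _ _ /allP hs _] := std; rewrite /srow.
case: (ltnP i (size S)) => h; last by rewrite nth_default.
exact: hs (mem_nth _ h).
Qed.

Lemma mem_urow i v : (v.+1 \in urow i) = (v < k * m) && ((v %% m).+1 \in srow i).
Proof.
apply/flattenP/andP => [[_ /mapP[t + ->] /mapP[x hx e]]|[hv hx]].
  rewrite mem_iota add0n => /andP[_ tk]; have /andP[x0 xm] := mem_srow hx.
  have -> : v = t * m + x.-1 by lia.
  rewrite modnMDl modn_small ?prednK //; split => //.
  have : t.+1 * m <= k * m by rewrite leq_mul2r tk orbT.
  by rewrite mulSn; lia.
have m0 : 0 < m by lia.
exists (map (addn (v %/ m * m)) (srow i)).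
  by apply/mapP; exists (v %/ m) => //; rewrite mem_iota add0n ltn_divLR.
by apply/mapP; exists (v %% m).+1 => //; rewrite addnS -divn_eq.
Qed.

Lemma urow_sorted i : sorted ltn (urow i).
Proof.
rewrite sorted_pairwise; last by move=> ? ? ?; exact: ltn_trans.
rewrite /urow; elim: k 0 => //= n IH t; rewrite pairwise_cat IH andbT.
apply/andP; split; last first.
  rewrite pairwise_map -sorted_pairwise; last by move=> ? ? ? /=; exact: ltn_trans.
  by apply: sub_sorted (srow_sorted i) => x z /=; rewrite ltn_add2l.
apply/allrelP => _ z /mapP[x /mem_srow hx ->] /flattenP[_ /mapP[u + ->] /mapP[x' /mem_srow hx' ->]].
rewrite mem_iota => /andP[tu _].
have : t.+1 * m <= u * m by rewrite leq_mul2r tu orbT.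
by rewrite mulSn /=; lia.
Qed.

Lemma urow_neq0 i : 0 \notin urow i.
Proof.
apply/negP => /flattenP[_ /mapP[u _ ->] /mapP[x' /mem_srow hx' e]].
by move: hx' e; lia.
Qed.

Lemma shp_power v i : shp U v i =
  (nth (0, [::]) S i).1 + count (fun x => x <= v) (urow i).
Proof. by rewrite shp_to_grid nth_kpower. Qed.

Lemma shp_power_first v i : v <= m -> shp U v i = shp (to_grid S) v i.
Proof.
move=> vm; rewrite shp_power shp_to_grid; congr addn; rewrite /urow.
rewrite -(prednK k_gt0) /= count_cat map_id_in; last by move=> x _; rewrite add0n.
rewrite [X in _ + X](_ : _ = 0) ?addn0 //; apply/eqP; rewrite -leqn0 leqNgt -has_count.
apply/hasPn => x /flattenP[_ /mapP[u + ->] /mapP[x' /mem_srow hx' ->]].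
rewrite mem_iota => /andP[tu _]; rewrite -ltnNge.
have : 1 * m <= u * m by rewrite leq_mul2r tu orbT.
lia.
Qed.

Lemma shp_power_inc v i : i < size S -> shp U v.+1 i = shp U v i + (i == letter v).
Proof.
move=> hi; rewrite !shp_power count_leS addnA; congr addn.
rewrite count_uniq_mem ?(sorted_uniq ltn_trans ltnn (urow_sorted i)) //.
congr nat_of_bool; rewrite mem_urow /letter; case: (ltnP v (k * m)) => hv /=; last first.
  by rewrite ltn_eqF.
have [_ _ pe _ _] := std.
have un : uniq (flatten [seq p.2 | p <- S]) by rewrite (perm_uniq pe) iota_uniq.
apply/idP/eqP => [h|e]; first by rewrite (find_flatten un h).
have hs : has (fun p => (v %% m).+1 \in p.2) S by rewrite has_find -e.
by have := nth_find (0, [::]) hs; rewrite -e.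
Qed.

Lemma letter_periodic v : v + m < k * m -> letter (v + m) = letter v.
Proof.
by move=> h; rewrite /letter h modnDr ifT //; apply: leq_trans h; rewrite ltnS leq_addr.
Qed.

Lemma shp_power_periodic v i : i < size S -> v + m <= k * m ->
  shp U (v + m) i = shp U v i + size (srow i).
Proof.
move=> hi; elim: v => [|v IH] h.
  rewrite add0n !shp_power_first // !shp_to_grid -!/(srow i) -addnA; congr addn.
  have -> : count (fun x => x <= 0) (srow i) = 0.
    apply/eqP; rewrite -leqn0 leqNgt -has_count; apply/hasPn => x /mem_srow.
    by rewrite -ltnNge => /andP[].
  by apply/eqP; rewrite -all_count; apply/allP => x /mem_srow /andP[].
rewrite addSn !shp_power_inc // letter_periodic // IH ?(ltnW h) //.
by rewrite addnAC.
Qed.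

(** Otherwise, in column [shp (to_grid S) v i], an entry above [v] in row [i] would sit over an
    entry at most [v] or over a hole, against column increase or the inner partition. *)
Lemma shp_skew_col v i : shp (to_grid S) v i.+1 <= shp (to_grid S) v i.
Proof.
have [hin hout _ _ hcol] := std.
case: (ltnP i.+1 (size S)) => hi; last by rewrite shp_default // size_map.
have okT : all row_ok (to_grid S).
  apply/(all_nthP [::]) => j _; rewrite nth_to_grid row_ok_skew ?srow_sorted //.
  by apply/negP => /mem_srow.
rewrite leqNgt; apply/negP => hlt.
set l := shp (to_grid S) v i in hlt.
have := ltnn l; rewrite {2}/l ltn_shp //.
move: hlt; rewrite ltn_shp // => /andP[ls le].
have hi' : i < size S by lia.
have szE j : j < size S -> size (nth [::] (to_grid S) j) = nth 0 (outer S) j.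
  by move=> hj; rewrite nth_to_grid size_cat size_nseq size_map (nth_map (0, [::])).
have := sortedP 0 hout i; rewrite size_map => /(_ hi) /=; rewrite -!szE // => hs.
rewrite (leq_trans ls hs) /=.
have := sortedP 0 hin i; rewrite size_map => /(_ hi) /=; rewrite !(nth_map (0, [::])) // => hn.
case ex : (cell (to_grid S) i l) => [x|//] /=.
case ey : (cell (to_grid S) i.+1 l) le => [y|] /= le.
  by have := hcol _ _ _ _ ex ey; lia.
move: ey ex ls; rewrite /cell !nth_to_grid !nth_cat !nth_nseq !size_nseq.
rewrite size_cat size_nseq size_map.
case: (ltnP l (nth _ S i.+1).1) => h.
  by rewrite (leq_trans h hn).
by move=> + _ hl; rewrite (nth_map 0) ?ltn_subLR.
Qed.

Lemma power_tab : tab U letter.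
Proof.
have inc v i : i < size S -> shp U v.+1 i = shp U v i + (i == letter v).
  exact: shp_power_inc.
split => //.
- apply/(all_nthP [::]) => j _; rewrite nth_to_grid nth_kpower.
  exact: row_ok_skew (urow_sorted j) (urow_neq0 j).
- elim/ltn_ind => v IH i; case: (ltnP i.+1 (size S)) => hi; last first.
    by rewrite shp_default // size_kpower_grid.
  have hi' : i < size S by lia.
  case: (leqP v m) => vm; first by rewrite !shp_power_first // shp_skew_col.
  case: (leqP v (k * m)) => vk.
    have e : v = v - m + m by lia.
    case: (posnP m) => m0; first by move: vk vm; rewrite m0; lia.
    (* Going back one period works because row [i] gains at least as many cells per period as row
       [i.+1]; this is where the decreasing row vector enters. *)
    rewrite e !shp_power_periodic -?e // leq_add ?IH //; first by lia.
    have := sortedP 0 dec i; rewrite size_map => /(_ hi) /=.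
    by rewrite !(nth_map (0, [::])).
  case: v vk {vm} IH => // v vk IH.
  have e : letter v = size S by rewrite /letter ltnNge -ltnS vk.
  by rewrite !inc // e !ltn_eqF // !addn0 IH.
- by move=> v i; rewrite size_kpower_grid; exact: inc.
Qed.

End Power.

Theorem theorem1p5 (b : nat) (S : sktab) :
  2 <= b ->
  standard_skew S ->
  size S = b ->
  all (fun p => size p.2 > 0) S ->
  sorted geq (row_vector S) ->
  stabilizes_at S (2 * b - 2).
Proof.
move=> b2 std sS /allP ne dec v /andP[vl vh].
set k := 2 * b - 2; set m := ncells S.
have k0 : 0 < k by lia.
have hU := power_tab std dec k0.
set U := to_grid (kpower S k) in hU *; set y := letter S k in hU.
have sU : size U = b by rewrite size_kpower_grid.
have v0 : 0 < v by exact: leq_ltn_trans vl.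
have m0 : 0 < m.
  by case: (posnP m) => // e; move: vl vh; rewrite -/m e; lia.
have l0 : level b m (k * m) U y b U y.
  split => //; first by move=> i bi; rewrite shp_default // sU.
have [w lw] : exists w, level b m (k * m) U y 0 (Rect (kpower S k)) w.
  rewrite /Rect /rect count_holes ?(tab_ok hU) // sU.
  apply: (level_iter m0 hU sU (R := fun i => size (nth (0, [::]) S i).2) _ _ l0) => //.
    by move=> u r rb; apply: shp_power_periodic; rewrite ?sS.
  move=> r rb; have := sortedP 0 dec r; rewrite size_map sS => /(_ rb) /=.
  by rewrite !(nth_map (0, [::])) ?sS // ltnW.
have hv : v.-1 < k * m by rewrite prednK.
have yb : y v.-1 < b.
  rewrite /y /letter hv -sS -has_find.
  have [_ _ pe _ _] := std.
  have : (v.-1 %% m).+1 \in flatten [seq p.2 | p <- S].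
    by rewrite (perm_mem pe) mem_iota add1n !ltnS leq0n ltn_mod.
  by case/flattenP => _ /mapP[p pS ->] h; apply/hasP; exists p.
have wy : w v.-1 = y v.-1.
  apply/eqP; rewrite (level_word lw) ?eqxx // hv andbT -ltnS prednK //.
  (* [tau 0 j] is at most [(b.-1).*2.-1], that is [2 * b - 3], the number [k.-1] of periods before
     the last one. *)
  apply: leq_ltn_trans vl; rewrite leq_mul2r /tau ltn0 /k; apply/orP; right; lia.
have sT := level_size lw.
rewrite -(prednK v0) (row_of_tab hU) ?sU // (row_of_tab (level_tab lw)) ?sT ?wy //.
Qed.
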